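(* Suppose that $\kappa$ is a measurable cardinal. Then $\mathfrak{b}_{\kappa}(\in^* )=\kappa^+$ and $\mathfrak{d}_{\kappa}(\in^* )=2^\kappa$. Moreover, $\mathfrak{d}_{\mathrm{Id}^{+}}(\in^* )=2^\kappa$, where $\mathrm{Id}^+$ is the function mapping $\alpha$ to $\alpha^+$.
   Context: Measurable cardinals are uncountable. Functions $h:\kappa\to\kappa$ used as parameters are assumed to take no finite values (the values of the identity below $\omega$ are irrelevant, since everything is modulo bounded sets). For $h:\kappa\to\kappa$, an $h$-slalom is a function $\varphi$ whose domain is a subset of $\kappa$ with bounded complement, such that $\varphi(\alpha)\subseteq\kappa$ and $|\varphi(\alpha)|=|h(\alpha)|$ for all $\alpha\in\mathrm{dom}(\varphi)$. For $f:\kappa\to\kappa$, write $f\in^*\varphi$ if $\{\alpha\in\mathrm{dom}(\varphi): f(\alpha)\notin\varphi(\alpha)\}$ is bounded in $\kappa$. $\mathfrak{b}_h(\in^* )$ is the least cardinality of a family $\mathcal F\subseteq\kappa^\kappa$ such that for every $h$-slalom $\varphi$ there is $f\in\mathcal F$ with $\neg(f\in^*\varphi)$. $\mathfrak{d}_h(\in^* )$ is the least cardinality of a family $\mathcal A$ of $h$-slaloms such that for every $f\in\kappa^\kappa$ there is $\varphi\in\mathcal A$ with $f\in^*\varphi$. $\mathfrak{b}_\kappa(\in^* )$ and $\mathfrak{d}_\kappa(\in^* )$ denote these cardinals for $h=\mathrm{Id}$, the identity function on $\kappa$. *)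

(* Defs.v *)
From mathcomp Require Import all_boot all_order.
From mathcomp Require Import boolp classical_sets functions cardinality filter.
From mathcomp Require Import wochoice.

Set Implicit Arguments.
Unset Strict Implicit.
Unset Printing Implicit Defensive.

Import Order.TTheory.
Local Open Scope classical_set_scope.
Local Open Scope card_scope.
Local Open Scope order_scope.

Definition card_lt T U (A : set T) (B : set U) : bool :=
  (A #<= B) && ~~ (B #<= A).

Notation "A '#<' B" := (card_lt A B) (at level 79) : card_scope.

(* [X] has the cardinality |A|^+. *)
Definition is_card_succ T U (A : set T) (X : set U) : Prop :=
  A #< X /\ forall V (Y : set V), A #< Y -> X #<= Y.

(* |X| is the least cardinality of a family satisfying [P].  Cardinal numbers
   are not objects here: "the invariant is |X|" is a relation between the
   invariant and [X], which determines [X] up to equipotence. *)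
Definition is_least_card T U (P : set (set T)) (X : set U) : Prop :=
  (exists2 F, P F & F #= X) /\ forall F, P F -> X #<= F.

Section Kappa.
Context {d : Order.disp_t} {K : orderType d}.

(* The elements of [K] stand for the ordinals below kappa; [below a] is the
   ordinal [a] as the set of its elements, so |a| is the cardinality of it. *)
Definition below (a : K) : set K := [set b | b < a].

(* The least ordinal of cardinality greater than |a|.  The default value [a]
   of [xget] is taken only if there is none in [K], which does not happen when
   kappa is a limit cardinal, in particular when it is measurable. *)
Definition ord_card_succ (a : K) : K :=
  let larger := [set b | below a #< below b] in
  xget a (larger `&` lbound larger).

Definition is_bounded (A : set K) : Prop := exists c, forall a, A a -> a < c.

(* Partial functions from [K] to the subsets of [K] are total functions into
   [option (set K)], [None] meaning "undefined". *)
Definition sdom (phi : K -> option (set K)) : set K := [set a | phi a <> None].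

(* No infiniteness of [h] is required: the finite values of the identity are
   taken on a bounded set, so they do not affect the two cardinals below. *)
Definition is_slalom (h : K -> K) (phi : K -> option (set K)) : Prop :=
  is_bounded (~` sdom phi) /\
  forall a A, phi a = Some A -> A #= below (h a).

Definition in_star (f : K -> K) (phi : K -> option (set K)) : Prop :=
  is_bounded [set a | exists2 A, phi a = Some A & ~ A (f a)].

(* b_h(in^* ) = |X| *)
Definition b_slalom_is (h : K -> K) U (X : set U) : Prop :=
  is_least_card
    [set F : set (K -> K) |
      forall phi, is_slalom h phi -> exists2 f, F f & ~ in_star f phi] X.

(* d_h(in^* ) = |X| *)
Definition d_slalom_is (h : K -> K) U (X : set U) : Prop :=
  is_least_card
    [set S : set (K -> option (set K)) |
      S `<=` is_slalom h /\
      forall f, exists2 phi, S phi & in_star f phi] X.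

End Kappa.

(* A cardinal kappa is given by a type [K] with a well-order isomorphic to the
   initial ordinal kappa. *)
Definition is_cardinal d (K : orderType d) : Prop :=
  well_order (<=%O : rel K) /\ forall a : K, below a #< [set: K].

(* Intersections of fewer than |K| members of [F] are in [F]. *)
Definition card_complete T (K : Type) (F : set_system T) : Prop :=
  forall S : set (set T), S `<=` F -> S #< [set: K] ->
    F (\bigcap_(A in S) A).

Definition is_measurable_cardinal d (K : orderType d) : Prop :=
  [/\ is_cardinal K,
      ~ countable [set: K] &
      exists F : set_system K,
        [/\ UltraFilter F,
            (forall a, F <> principal_filter a) &
            card_complete K F]].

(* Main.v *)
Require Import Defs.
From mathcomp Require Import all_boot all_order.
From mathcomp Require Import boolp classical_sets functions cardinality filter.
From mathcomp Require Import wochoice.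
Local Open Scope classical_set_scope.

(** Both invariants are controlled by the ultrapower of kappa by a normal
    ultrafilter D, here unfolded into combinatorics on kappa.

    Call two functions on kappa D-distinct if they differ on a set of D.  Let
    phi be a slalom with |phi(a)| = |a|, and inject each phi(a) into a.  The
    values of a captured function then become a function that is regressive on
    a set of D, so by normality it is coded by a constant, and D-distinct
    functions have distinct codes: phi captures at most kappa pairwise
    D-distinct functions ([fodor_card_le]).  If only |phi(a)| = |a^+|, the codes lie below a^+.
    Comparing codes modulo D is then a total preorder on the captured
    functions, in which every function has at most kappa predecessors by the
    first case, so there are at most kappa^+ of them
    ([fodor_card_le_succ]).

    A measurable cardinal is a strong limit ([measurable_powerset_le]), so that
    each subset x of kappa gives a function f_x, where f_x(a) codes the
    intersection of x and a.  These are 2^kappa pairwise D-distinct functions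
    ([exists_separated]).  Hence kappa^+ of them cannot all be captured by one
    slalom, while diagonalization captures any kappa functions by one slalom:
    this is the value of b.

    For d, a family S of slaloms that captures all functions has more than
    kappa elements by diagonalization, hence at least kappa^+.  As it captures
    the 2^kappa functions f_x and each of its members captures at most
    kappa^+ <= |S| of them, 2^kappa <= |S| |S| = |S|
    ([card_powerset_le_predicting]).  The argument is the same for the identity
    and for the cardinal successor, since all ordinals below a^+ have
    cardinality at most |a|.

    Cardinal arithmetic is needed for sets of different types; it is derived
    from Zorn's lemma in the form of comparability of cardinals
    ([card_le_total]) and |A| |A| = |A| for infinite A ([card_square_le]). *)

Set Implicit Arguments.
Unset Strict Implicit.
Unset Printing Implicit Defensive.

Import Order.TTheory.
Local Open Scope card_scope.

(** * Cardinal arithmetic *)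

Lemma set_inj_card_le T U (A : set T) (B : set U) (f : T -> U) :
  set_fun A B f -> set_inj A f -> A #<= B.
Proof.
move=> fAB fI; suff [g] : $|{injfun A >-> B}| by exact: inj_card_le.
by apply/injfunPex; exists f.
Qed.

(** The point [u0] gives the injection its values outside [A]. *)
Lemma card_le_set_inj T U (u0 : U) (A : set T) (B : set U) :
  A #<= B -> exists2 f : T -> U, set_fun A B f & set_inj A f.
Proof.
elim/Ppointed: U => [U|U] in u0 B *; first by have := no u0.
by move=> /pcard_leP/injfunPex.
Qed.

(** Relations replace functions where the target type may be empty. *)
Lemma rel_card_le T U (A : set T) (B : set U) (R : T -> U -> Prop) :
  (forall x, A x -> exists2 y, B y & R x y) ->
  (forall x x' y, A x -> A x' -> R x y -> R x' y -> x = x') ->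
  A #<= B.
Proof.
move=> Rtot Rinj; have [[u0 _]|nU] := pselect (exists u : U, True); last first.
  suff -> : A = set0 by exact: card_ge0.
  by rewrite -subset0 => x /Rtot[y _ _]; apply: nU; exists y.
have /choice[f fP] x : exists y, A x -> B y /\ R x y.
  have [Ax|nAx] := pselect (A x); last by exists u0.
  by have [y By Rxy] := Rtot x Ax; exists y.
apply: (@set_inj_card_le _ _ _ _ f) => [x Ax|x y /[!inE] Ax Ay fxy].
  by have [] := fP x Ax.
apply: (Rinj _ _ (f x)) => //; first by have [] := fP x Ax.
by rewrite fxy; have [] := fP y Ay.
Qed.

(** A maximal graph of a partial injection from [A] to [B] is total on one of
    the two sides. *)
Lemma card_le_total T U (A : set T) (B : set U) : A #<= B \/ B #<= A.
Proof.
pose P := [set G : set (T * U) |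
  (forall p, G p -> A p.1 /\ B p.2) /\
  (forall p q, G p -> G q -> p.1 = q.1 <-> p.2 = q.2)].
have [|G [[GAB GI] Gmax]] := @Zorn_bigcup _ P.
  move=> F FP Fchain; split=> [p [G FG Gp]|p q [G FG Gp] [H FH Hq]].
    exact: (FP _ FG).1.
  have [GH|HG] := Fchain _ _ FG FH.
    by apply: (FP _ FH).2 => //; exact: GH.
  by apply: (FP _ FG).2 => //; exact: HG.
have [Adom|/existsNP[a /not_implyP[Aa nGa]]] :=
    pselect (forall x, A x -> exists y, G (x, y)).
  left; apply: (@rel_card_le _ _ _ _ (fun x y => G (x, y))).
    by move=> x /Adom[y Gxy]; exists y => //; case: (GAB _ Gxy).
  by move=> x x' y _ _ Gxy Gx'y; apply/(GI _ _ Gxy Gx'y).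
have [Bran|/existsNP[b /not_implyP[Bb nGb]]] :=
    pselect (forall y, B y -> exists x, G (x, y)).
  right; apply: (@rel_card_le _ _ _ _ (fun y x => G (x, y))).
    by move=> y /Bran[x Gxy]; exists x => //; case: (GAB _ Gxy).
  by move=> y y' x _ _ Gxy Gxy'; apply/(GI _ _ Gxy Gxy').
exfalso; apply: (Gmax (G `|` [set (a, b)])).
  split=> [p Gp|sub]; first by left.
  by apply: nGa; exists b; apply: sub; right.
split=> [p [/GAB//|->//]|p q [Gp|->] [Gq|->]] //=.
- exact: GI.
- by split=> e; [case: nGa; exists p.2 | case: nGb; exists p.1];
    rewrite -e -surjective_pairing.
- by split=> e; [case: nGa; exists q.2 | case: nGb; exists q.1];
    rewrite e -surjective_pairing.
Qed.

Lemma card_le_bigcup_square I T U (J : set I) (F : I -> set T) (B : set U) :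
  B `*` B #<= B -> J #<= B -> (forall i, J i -> F i #<= B) ->
  \bigcup_(i in J) F i #<= B.
Proof.
move=> B2 JB FB; apply: card_le_trans B2.
have [->|/set0P[x0 [i0 Ji0 Fx0]]] := eqVneq (\bigcup_(i in J) F i) set0.
  exact: card_ge0.
have [u0 _] : exists u : U, True.
  apply: contrapT => nU; have B0 : B = set0.
    by rewrite -subset0 => u; case: nU; exists u.
  by move: JB; rewrite B0 => /card_le0P J0; move: Ji0; rewrite J0.
have [j jB jI] := card_le_set_inj u0 JB.
have /choice[k kP] i : exists k : T -> U,
    J i -> set_fun (F i) B k /\ set_inj (F i) k.
  have [Ji|nJi] := pselect (J i); last by exists (fun=> u0).
  by have [k kB kI] := card_le_set_inj u0 (FB i Ji); exists k.
apply: (@rel_card_le _ _ _ _ (fun x p => exists i,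
  [/\ J i, F i x & p = (j i, k i x)])).
  move=> x [i Ji Fix]; exists (j i, k i x); last by exists i.
  by split; [exact: jB | exact: (kP i Ji).1].
move=> x x' _ _ _ [i [Ji Fix ->]] [i' [Ji' Fix' [ej ek]]].
have ii' : i = i' by apply: jI; rewrite ?inE.
rewrite -ii' in Fix' ek.
by apply: (kP i Ji).2; rewrite ?inE.
Qed.

Lemma card_le_setU_square T U (E F : set T) (B : set U) :
  infinite_set B -> B `*` B #<= B -> E #<= B -> F #<= B -> E `|` F #<= B.
Proof.
move=> /infiniteP natB B2 EB FB; rewrite -bigcup2E.
apply: card_le_bigcup_square => //.
by move=> [|[|i]] _ /=; rewrite ?card_ge0.
Qed.

Lemma card_le_square T U (A : set T) (B : set U) :
  A #<= B -> A `*` A #<= B `*` B.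
Proof.
have [->|/set0P[a Aa]] := eqVneq A set0; first by rewrite set0X card_ge0.
move=> AB; have [u0 _] : exists u, B u.
  apply: contrapT => nB; have B0 : B = set0.
    by rewrite -subset0 => u Bu; apply: nB; exists u.
  by move: AB Aa; rewrite B0 => /card_le0P ->.
have [f fAB fI] := card_le_set_inj u0 AB.
apply: (@set_inj_card_le _ _ _ _ (fun p => (f p.1, f p.2))).
  by move=> p [/= /fAB ? /fAB ?].
move=> [x y] [x' y'] /[!inE] -[/= Ax Ay] [/= Ax' Ay'] [].
move=> /(fI _ _ (mem_set Ax) (mem_set Ax')) ->.
by move=> /(fI _ _ (mem_set Ay) (mem_set Ay')) ->.
Qed.

(** Take a maximal graph [G] of an injection from B x B to B, where B is an
    infinite subset of [A].  If [A `\` B] had a subset C as large as B, the rest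
    of (B `|` C) x (B `|` C) could be sent injectively into C, and [G] would
    extend.  Hence [A `\` B] is smaller than B, and |A| = |B|. *)
Lemma card_square_le T (A : set T) : infinite_set A -> A `*` A #<= A.
Proof.
move=> Ainf.
(* [fld G] is the set B such that [G] is the graph of an injection on B x B. *)
pose fld (G : set ((T * T) * T)) := [set x | exists z, G ((x, x), z)].
pose P := [set G | [/\ fld G `<=` A, G = set0 \/ infinite_set (fld G),
  forall p, G p -> [/\ fld G p.1.1, fld G p.1.2 & fld G p.2],
  forall x y, fld G x -> fld G y -> exists z, G ((x, y), z) &
  forall p q, G p -> G q -> p.1 = q.1 <-> p.2 = q.2]].
have [|G [[GA Ginf Gfld Gtot GI] Gmax]] := @Zorn_bigcup _ P.
  move=> F FP Fchain.
  have fldS G H : G `<=` H -> fld G `<=` fld H.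
    by move=> GH x [z Gz]; exists z; exact: GH.
  split.
  - by move=> x [z [G FG Gz]]; have [GA _ _ _ _] := FP _ FG; apply: GA; exists z.
  - have [[G FG [p Gp]]|F0] := pselect (exists2 G, F G & G !=set0); last first.
      left; rewrite -subset0 => p [G FG Gp].
      by apply: F0; exists G => //; exists p.
    right; have [_ Ginf _ _ _] := FP _ FG.
    case: Ginf Gp => [->//|Ginf _]; apply: sub_infinite_set Ginf.
    by apply: fldS => q Gq; exists G.
  - move=> p [G FG Gp]; have [_ _ Gfld _ _] := FP _ FG.
    have GF : G `<=` \bigcup_(X in F) X by move=> q Gq; exists G.
    by have [? ? ?] := Gfld _ Gp; split; apply: fldS GF _ _.
  - move=> x y [z [G FG Gz]] [t [H FH Ht]].
    have [GH|HG] := Fchain _ _ FG FH.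
      have [_ _ _ Htot _] := FP _ FH.
      have [||u Hu] := Htot x y; [by exists z; exact: GH | by exists t |].
      by exists u; exists H.
    have [_ _ _ Gtot _] := FP _ FG.
    have [||u Gu] := Gtot x y; [by exists z | by exists t; exact: HG |].
    by exists u; exists G.
  - move=> p q [G FG Gp] [H FH Hq].
    have [GH|HG] := Fchain _ _ FG FH.
      by have [_ _ _ _ ->] := FP _ FH => //; exact: GH.
    by have [_ _ _ _ ->] := FP _ FG => //; exact: HG.
set B := fld G in GA Ginf Gfld Gtot.
(* With [B = set0], this also shows that a maximal [G] is not empty. *)
have Bmax C : C `<=` A -> infinite_set C -> B `&` C = set0 ->
    ~ ((B `|` C) `*` (B `|` C) #<= C).
  move=> CA Cinf BC0 sqC; have [c0 Cc0] := infinite_setN0 Cinf.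
  have [j jC jI] := card_le_set_inj c0 sqC.
  pose D := (B `|` C) `*` (B `|` C) `\` B `*` B.
  pose G' := G `|` [set p | D p.1 /\ p.2 = j p.1].
  have nBC x : B x -> C x -> False.
    by move=> Bx Cx; have : (B `&` C) x by []; rewrite BC0.
  have fldG' : fld G' = B `|` C.
    apply/seteqP; split=> x.
      by move=> [z [Gz|[[[/= BCx _] _] _]]] //; left; exists z.
    move=> [[z Gz]|Cx]; first by exists z; left.
    exists (j (x, x)); right; split=> //; split; first by split; right.
    by move=> [Bx _]; exact: nBC Bx Cx.
  apply: (Gmax G').
    split=> [p Gp|G'G]; first by left.
    suff Bc0 : B c0 by exact: nBC Bc0 Cc0.
    exists (j (c0, c0)); apply: G'G; right; split=> //=.
    by split; [split; right | move=> [Bc0 _]; exact: nBC Bc0 Cc0].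
  split; rewrite ?fldG'.
  - by move=> x [/GA|/CA].
  - by right; apply: sub_infinite_set Cinf => x; right.
  - move=> p [/Gfld[Bx By Bz]|[[[BCx BCy] _] ->]]; first by split; left.
    by split=> //; right; exact: jC.
  - move=> x y BCx BCy; have [[Bx By]|nB] := pselect ((B `*` B) (x, y)).
      by have [z Gz] := Gtot x y Bx By; exists z; left.
    by exists (j (x, y)); right.
  - move=> p q [Gp|[[BCp nBp] pj]] [Gq|[[BCq nBq] qj]].
    + exact: GI.
    + split=> [pq|pq].
        by case: nBq; rewrite -pq; have [? ? _] := Gfld _ Gp; split.
      by have [_ _ Bz] := Gfld _ Gp; case: (nBC _ Bz); rewrite pq qj; exact: jC.
    + split=> [pq|pq].
        by case: nBp; rewrite pq; have [? ? _] := Gfld _ Gq; split.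
      by have [_ _ Bz] := Gfld _ Gq; case: (nBC _ Bz); rewrite -pq pj; exact: jC.
    + rewrite pj qj; split=> [-> //|]; apply: jI; exact/mem_set.
have Binf : infinite_set B.
  case: Ginf => // G0 _.
  have B0 : B = set0 by rewrite -subset0 => x [z]; rewrite G0.
  have [a0 _] := infinite_setN0 Ainf.
  have [f fA fI] := card_le_set_inj a0 ((infiniteP A).1 Ainf).
  have /card_eqPle[rnat natr] : range f #= [set: nat] by exact: inj_card_eq.
  have rinf : infinite_set (range f) by exact/infiniteP.
  apply: (Bmax (range f)) => //; first by move=> _ [n _ <-]; exact: fA.
    by rewrite B0 set0I.
  rewrite B0 set0U; apply: card_le_trans ((infiniteP _).1 rinf).
  exact: countableX.
have B2 : B `*` B #<= B.
  apply: (@rel_card_le _ _ _ _ (fun p z => G (p, z))).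
    move=> [x y] [/= Bx By]; have [z Gz] := Gtot _ _ Bx By.
    by exists z => //; have [_ _] := Gfld _ Gz.
  by move=> p q z _ _ Gp Gq; apply/(GI _ _ Gp Gq).
suff AB : A #<= B.
  apply: card_le_trans (card_le_trans B2 (subset_card_le GA)).
  exact: card_le_square.
have [DB|BD] := card_le_total (A `\` B) B.
  by rewrite -(setDUK GA); exact: card_le_setU_square.
have [b0 Bb0] := infinite_setN0 Binf.
have [f fAB fI] := card_le_set_inj b0 BD.
have /card_eqPle[fB Bf] : f @` B #= B by exact: inj_card_eq.
exfalso; apply: (Bmax (f @` B)).
- by move=> y [x Bx <-]; have [] := fAB _ Bx.
- by move=> /(card_le_finite Bf).
- by rewrite -subset0 => y [By [x Bx fxy]]; have [_] := fAB _ Bx; rewrite fxy.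
apply: (card_le_trans (card_le_trans _ B2) Bf); apply: card_le_square.
exact: card_le_setU_square.
Qed.

Lemma card_le_bigcup I T U (J : set I) (F : I -> set T) (B : set U) :
  infinite_set B -> J #<= B -> (forall i, J i -> F i #<= B) ->
  \bigcup_(i in J) F i #<= B.
Proof. by move=> /card_square_le; exact: card_le_bigcup_square. Qed.

Lemma card_le_setU T U (E F : set T) (B : set U) :
  infinite_set B -> E #<= B -> F #<= B -> E `|` F #<= B.
Proof. by move=> Binf; apply: card_le_setU_square => //; exact: card_square_le. Qed.

(** If every element of a total preorder has at most |A| predecessors, the
    preorder has at most |A|^+ elements: an injection of [S] into [W] would be
    cofinal, so that [W] would be a union of |S| sets of at most |A| elements. *)
Lemma card_le_cofinal T U V (r : T -> T -> Prop) (W : set T) (A : set U)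
    (S : set V) :
  infinite_set A -> (forall x y, W x -> W y -> r x y \/ r y x) ->
  (forall y, W y -> W `&` r^~ y #<= A) ->
  ~ (S #<= A) -> W #<= S.
Proof.
move=> Ainf rtot rA nSA; have [//|SW] := card_le_total W S.
have AS : A #<= S by have [/nSA|] := card_le_total S A.
have [w0 _] : exists w, W w.
  apply: contrapT => nW; have W0 : W = set0.
    by rewrite -subset0 => u Wu; apply: nW; exists u.
  by apply: nSA; move: SW; rewrite W0 => /card_le0P ->; exact: card_ge0.
have [f fSW fI] := card_le_set_inj w0 SW.
apply: (@card_le_trans _ _ _ (\bigcup_(s in S) (W `&` r^~ (f s)))).
  apply: subset_card_le => w Ww; apply: contrapT => nw; apply: nSA.
  apply: card_le_trans (rA w Ww); apply: (@set_inj_card_le _ _ _ _ f) => // s Ss.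
  split; first exact: fSW.
  have [//|] := rtot (f s) w (fSW _ Ss) Ww.
  by move=> rw; case: nw; exists s.
apply: card_le_bigcup => //.
  by move=> /(card_le_finite AS).
by move=> s Ss; apply: card_le_trans AS; exact/rA/fSW.
Qed.

(** Cantor's theorem. *)
Lemma powerset_not_card_le T : ~ ([set: set T] #<= [set: T]).
Proof.
move=> /pcard_surjP[g /(_ [set x | ~ g x x] I)[x _ gx]].
have : g x x <-> ~ g x x by rewrite {1}gx.
tauto.
Qed.

Lemma card_lt_not_le T U (A : set T) (B : set U) : (A #< B) <-> ~ (B #<= A).
Proof.
split=> [/andP[_ /negP]//|nBA]; apply/andP; split; last exact/negP.
by have [|/nBA] := card_le_total A B.
Qed.

Lemma well_order_min (T : eqType) (R : rel T) (A : set T) :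
  well_order R -> A !=set0 -> exists2 m, A m & forall x, A x -> R m x.
Proof.
move=> wR [a Aa]; have [|m [[]]] := wR (mem A); first by exists a; rewrite inE.
by rewrite inE => Am mmin _; exists m => // x Ax; apply: mmin; rewrite inE.
Qed.

(** Well-order the power set of [T]; the elements with at most |T| predecessors
    form an initial segment of cardinality |T|^+. *)
Lemma exists_card_succ T :
  infinite_set [set: T] -> exists X : set (set T), is_card_succ [set: T] X.
Proof.
move=> Tinf; have [R wR] := well_ordering_principle (set T).
have wRc : wo_chain R predT by exact: withinW.
have Rtot x y : R x y \/ R y x.
  by apply/orP; exact: (wo_chainW wRc).
have Ranti x y : R x y -> R y x -> x = y.
  by move=> Rxy Ryx; apply: (wo_chain_antisymmetric wRc) => //; rewrite Rxy.
pose X := [set x | [set y | R y x] #<= [set: T]].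
exists X; split.
  apply/card_lt_not_le => XT.
  have [|m nXm mmin] := @well_order_min _ R (~` X) wR.
    apply: contrapT => nX; apply: (@powerset_not_card_le T).
    apply: card_le_trans XT; apply: subset_card_le => x _.
    by apply: contrapT => nXx; apply: nX; exists x.
  apply: nXm; have mT : [set m] #<= [set: T].
    apply: card_le_trans ((infiniteP _).1 Tinf).
    exact: countable1.
  apply: card_le_trans (card_le_setU Tinf XT mT).
  apply: subset_card_le => y /= Rym; apply: contrapT => /not_orP[nXy ym].
  by apply: ym; apply: Ranti Rym _; exact: mmin.
move=> V Y /card_lt_not_le nYT.
apply: (@card_le_cofinal _ _ _ (fun x y => R x y) _ [set: T]) => //.
move=> y Xy; apply: card_le_trans Xy; apply: subset_card_le => x [] //.
Qed.

(** * Measures on an uncountable cardinal *)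

Local Open Scope order_scope.

Section UncountableCardinal.
Context {d : Order.disp_t} {K : orderType d}.
Hypotheses (cardK : is_cardinal K) (uncK : ~ countable [set: K]).

Lemma not_card_le_below (a : K) : ~ ([set: K] #<= below a).
Proof. by apply/card_lt_not_le; exact: cardK.2. Qed.

Lemma infinite_cardinal : infinite_set [set: K].
Proof. by move=> /finite_set_countable. Qed.

(** Otherwise all ordinals below kappa are finite, and an infinite sequence in
    [K] is cofinal: [K] is a countable union of finite sets. *)
Lemma infinite_below : exists c : K, forall a, c <= a -> infinite_set (below a).
Proof.
have [a0 _] := infinite_setN0 infinite_cardinal.
have [c cinf] : exists c : K, infinite_set (below c).
  apply: contrapT => nc; apply: uncK.
  have belowfin (b : K) : finite_set (below b) by apply: contrapT => ?; apply: nc; exists b.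
  have [f _ fI] := card_le_set_inj a0 ((infiniteP _).1 infinite_cardinal).
  apply: (@sub_countable _ _ _ (\bigcup_(n in [set: nat]) below (f n))); last first.
    by apply: bigcup_countable => // n _; exact: finite_set_countable.
  apply: subset_card_le => c _; apply: contrapT => ncf.
  have rinf : infinite_set (range f).
    have /card_eqPle[_ natr] := inj_card_eq fI.
    by move=> /(card_le_finite natr)/infinite_nat.
  have finc : finite_set [set c] by exact: finite_set1.
  apply: (infinite_setD rinf finc); apply: sub_finite_set (belowfin c).
  move=> _ [[n _ <-] /= fnc]; rewrite /below /= lt_neqAle; apply/andP; split.
    exact/eqP.
  by rewrite leNgt; apply/negP => cfn; apply: ncf; exists n.
exists c => a ca; apply: sub_infinite_set cinf => b /= bc.
exact: lt_le_trans bc ca.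
Qed.

Lemma ex_least (A : set K) : A !=set0 -> exists2 m, A m & forall x, A x -> m <= x.
Proof. exact: well_order_min cardK.1. Qed.

Section Measure.
Variable U : set_system K.
Hypotheses (U_ultra : UltraFilter U) (U_npr : forall a, U <> principal_filter a)
  (U_comp : card_complete K U).

Lemma measure_bigcap I (J : set I) (G : I -> set K) :
  ~ ([set: K] #<= J) -> (forall i, J i -> U (G i)) ->
  U (\bigcap_(i in J) G i).
Proof.
move=> nKJ UG; rewrite -(bigcap_image J G id); apply: U_comp.
  by move=> _ [i Ji <-]; exact: UG.
apply/card_lt_not_le => KG; apply: nKJ; apply: card_le_trans KG _.
exact: card_image_le.
Qed.

Lemma measure_neq (a : K) : U [set b | b <> a].
Proof.
have [Ua|//] := @in_ultra_setVsetC _ _ [set b | b = a] U_ultra.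
exfalso; apply: (U_npr (a := a)); apply/seteqP; split=> A.
  by move=> UA; apply/principal_filterP; have [b [Ab <-]] := filter_ex (filterI UA Ua).
by move=> /principal_filterP Aa; apply: filterS Ua => _ ->.
Qed.

Lemma measure_gt (c : K) : U [set a | c < a].
Proof.
have Uge : U (\bigcap_(b in below c) [set a | a <> b]).
  by apply: measure_bigcap => [|b _]; [exact: not_card_le_below | exact: measure_neq].
apply: filterS2 Uge (measure_neq c) => a /= ge nac.
by rewrite ltNge; apply/negP; rewrite le_eqVlt => /orP[/eqP|/ge]; exact.
Qed.

(** In the ultrapower by [U], [g] represents the least ordinal above all the
    constants; it exists as [U] is closed under countable intersections, so that
    the ultrapower is well-founded. *)
Lemma measure_least_unbounded : exists2 g : K -> K,
  (forall c, U [set k | c < g k]) &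
  forall g', U [set k | g' k < g k] -> exists c, ~ U [set k | c < g' k].
Proof.
apply: contrapT => nmin.
pose N := {g : K -> K | forall c, U [set k | c < g k]}.
have /choice[s sP] (g : N) : exists g' : N, U [set k | sval g' k < sval g k].
  apply: contrapT => ng; apply: nmin; exists (sval g); first exact: (svalP g).
  move=> g' g'g; apply: contrapT => nc; apply: ng.
  have g'N c : U [set k | c < g' k] by apply: contrapT => ?; apply: nc; exists c.
  by exists (exist _ g' g'N).
pose h n : N := iter n s (exist _ id measure_gt).
have Uh : U (\bigcap_n [set k | sval (h n.+1) k < sval (h n) k]).
  by apply: measure_bigcap => [/uncK|n _]; last exact: (sP (h n)).
have [k hk] := filter_ex Uh.
have [|m [n _ <-] mmin] := @ex_least (range (fun n => sval (h n) k)).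
  by exists (sval (h 0%N) k); exists 0%N.
have := hk n I; apply/negP; rewrite -leNgt; apply: mmin.
by exists n.+1.
Qed.

End Measure.

(** Normality in the form of the pressing-down lemma: a function that is
    regressive on a set of [D] is constant on a set of [D]. *)
Definition is_normal (D : set_system K) : Prop :=
  [/\ ProperFilter D, forall A, D A \/ D (~` A), forall c, D [set a | c < a] &
      forall f : K -> K, D [set a | f a < a] -> exists c, D [set a | f a = c]].

(** [D] is the image of [U] by a least unbounded function [g]: if f is regressive
    modulo [D], then f \o g is below [g] modulo [U], hence bounded, hence constant
    by completeness. *)
Lemma exists_normal (U : set_system K) :
  UltraFilter U -> (forall a, U <> principal_filter a) -> card_complete K U ->
  exists D, is_normal D.
Proof.
move=> U_ultra U_npr U_comp.
have [g gN gmin] := measure_least_unbounded U_ultra U_npr U_comp.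
exists (fmap g U); split.
- exact: fmap_proper_filter.
- by move=> A; exact: (in_ultra_setVsetC (g @^-1` A)).
- exact: gN.
move=> f fg; have [c nUc] := gmin (f \o g) fg.
have [//|Ule] := in_ultra_setVsetC [set k | c < f (g k)] U_ultra.
apply: contrapT => nconst.
have Une b : U [set k | f (g k) <> b].
  have [Ub|//] := in_ultra_setVsetC [set k | f (g k) = b] U_ultra.
  by exfalso; apply: nconst; exists b.
have Uge : U (\bigcap_(b in below c) [set k | f (g k) <> b]).
  by apply: measure_bigcap => // ; exact: not_card_le_below.
have [k [[ge ne] /negP]] := filter_ex (filterI (filterI Uge (Une c)) Ule).
rewrite -leNgt le_eqVlt => /orP[/eqP //|/ge]; exact.
Qed.

(** If K injects into the power set of [a] by i, then for each [b < a] the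
    ultrafilter decides whether [b] is in i(k); by completeness the decisions
    taken together hold on a set of [U], where i is constant although it is
    injective. *)
Lemma measurable_powerset_le (U : set_system K) (a : K) :
  UltraFilter U -> (forall a, U <> principal_filter a) -> card_complete K U ->
  [set x | x `<=` below a] #<= [set: K].
Proof.
move=> U_ultra U_npr U_comp.
have [//|] := card_le_total [set x | x `<=` below a] [set: K].
move=> /(card_le_set_inj set0)[i ia iI].
pose S b := [set k | i k b].
have /choice[s sP] b : exists s : bool, U (if s then S b else ~` S b).
  by have [?|?] := in_ultra_setVsetC (S b) U_ultra; [exists true|exists false].
have UI : U (\bigcap_(b in below a) (if s b then S b else ~` S b)).
  by apply: measure_bigcap => //; exact: not_card_le_below.
have [k kI] := filter_ex UI.
have [k' [k'I k'k]] := filter_ex (filterI UI (measure_neq U_ultra U_npr k)).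
exfalso; apply: k'k; apply: iI; rewrite ?inE //.
apply/seteqP; split=> b ib.
  have ba := ia k' I b ib; have := kI b ba; have := k'I b ba.
  by case: (s b) => // /(_ ib).
have ba := ia k I b ib; have := kI b ba; have := k'I b ba.
by case: (s b) => // _ /(_ ib).
Qed.

(** The value of [f x] at [a] is a code for the intersection of [x] and [a]; it
    tells [x] from [y] as soon as [a] is past an element of one of them only. *)
Lemma exists_separated : (forall a : K, [set x | x `<=` below a] #<= [set: K]) ->
  exists f : set K -> K -> K, forall x y, x <> y ->
    exists c, forall a, c < a -> f x a <> f y a.
Proof.
move=> powK; have [a0 _] := infinite_setN0 infinite_cardinal.
have /choice[e eP] a : exists e : set K -> K, set_inj [set x | x `<=` below a] e.
  by have [e _ eI] := card_le_set_inj a0 (powK a); exists e.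
have eE x y c a : c < a -> e a (x `&` below a) = e a (y `&` below a) ->
    x c -> y c.
  move=> ca exy xc; have := eP a (x `&` below a) (y `&` below a).
  rewrite !inE => /(_ _ _ exy) xya; suff [] : (y `&` below a) c by [].
  by rewrite -xya; [split | move=> ? [] | move=> ? []].
exists (fun x a => e a (x `&` below a)) => x y xy; apply: contrapT => nc.
apply: xy; apply/seteqP; split=> c xc; apply: contrapT => nyc; apply: nc;
  exists c => a ca exy; apply: nyc.
  exact: eE ca exy xc.
exact: eE ca (esym exy) xc.
Qed.

(** * Counting functions modulo a normal ultrafilter *)

Section Fodor.
Variable D : set_system K.
Hypothesis D_normal : is_normal D.

Let D_proper : ProperFilter D. Proof. by case: D_normal. Qed.
Local Existing Instance D_proper.

(** Injecting [B a] into the ordinal [a] turns each [g w] into a regressive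
    function; its constant value determines [w], since the functions are
    pairwise distinct modulo [D]. *)
Lemma fodor_card_le T (W : set T) (g : T -> K -> K) (B : K -> set K) :
  D [set a | B a #<= below a] ->
  (forall w, W w -> D [set a | B a (g w a)]) ->
  (forall w w', W w -> W w' -> w <> w' -> D [set a | g w a <> g w' a]) ->
  W #<= [set: K].
Proof.
have [_ _ _ Dfodor] := D_normal; move=> DB DW Dneq.
have /choice[e eP] a : exists e : K -> K, B a #<= below a ->
    set_fun (B a) (below a) e /\ set_inj (B a) e.
  have [/(card_le_set_inj a)[e]|nB] := pselect (B a #<= below a); first by exists e.
  by exists id.
apply: (@rel_card_le _ _ _ _ (fun w c => D [set a | e a (g w a) = c])).
  move=> w Ww; have [|c Dc] := Dfodor (fun a => e a (g w a)); last by exists c.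
  by apply: filterS2 DB (DW w Ww) => a /eP[+ _] /=; apply.
move=> w w' c Ww Ww' Dwc Dw'c; apply: contrapT => ww'.
have [a [[ac ac'] [[Ba [Bw Bw']]]]] := filter_ex
  (filterI (filterI Dwc Dw'c) (filterI (filterI DB (filterI (DW w Ww) (DW w' Ww')))
    (Dneq w w' Ww Ww' ww'))).
by apply; have [_] := eP a Ba; apply; rewrite ?inE //= ac ac'.
Qed.

(** Compare functions by their codes [e a (g w a)] below [h a], modulo [D].  The
    predecessors of a given function take their values in sets of cardinality
    at most |a|, to which the previous lemma applies. *)
Lemma fodor_card_le_succ (h : K -> K) T (W : set T) (g : T -> K -> K)
    (B : K -> set K) V (S : set V) :
  (forall a b, b < h a -> below b #<= below a) ->
  D [set a | B a #<= below (h a)] ->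
  (forall w, W w -> D [set a | B a (g w a)]) ->
  (forall w w', W w -> W w' -> w <> w' -> D [set a | g w a <> g w' a]) ->
  ~ (S #<= [set: K]) -> W #<= S.
Proof.
have [_ Dultra Dgt _] := D_normal; move=> hcard DB DW Dneq.
have /choice[e eP] a : exists e : K -> K, B a #<= below (h a) ->
    set_fun (B a) (below (h a)) e /\ set_inj (B a) e.
  have [/(card_le_set_inj a)[e]|nB] := pselect (B a #<= below (h a)).
    by exists e.
  by exists id.
apply: (@card_le_cofinal _ _ _
    (fun w w' => D [set a | e a (g w a) <= e a (g w' a)])).
- exact: infinite_cardinal.
- move=> w w' _ _; have [|Dgt'] := Dultra [set a | e a (g w a) <= e a (g w' a)].
    by left.
  by right; apply: filterS Dgt' => a /= /negP; rewrite -ltNge => /ltW.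
move=> y Wy; have [c cinf] := infinite_below.
apply: (@fodor_card_le _ _ g
    (fun a => B a `&` [set z | e a z <= e a (g y a)])).
- apply: filterS3 DB (DW y Wy) (Dgt c) => a Ba By /ltW/cinf ainf.
  have [eB eI] := eP a Ba.
  have code_le : [set b | b <= e a (g y a)] #<= below a.
    apply: (@card_le_trans _ _ _ (below (e a (g y a)) `|` [set e a (g y a)])).
      by apply: subset_card_le => b /=; rewrite le_eqVlt => /orP[/eqP|]; [right|left].
    apply: card_le_setU => //; first exact/hcard/eB.
    apply: card_le_trans ((infiniteP _).1 ainf); exact: countable1.
  apply: card_le_trans code_le; apply: (@set_inj_card_le _ _ _ _ (e a)).
    by move=> z [].
  move=> z z' /[!inE] -[Bz _] [Bz' _]; apply: eI; exact/mem_set.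
- by move=> w [Ww Dwy]; apply: filterI => //; exact: DW.
- by move=> w w' [Ww _] [Ww' _]; exact: Dneq.
Qed.

Lemma slalom_card_le (h : K -> K) phi (a : K) :
  is_slalom h phi -> odflt set0 (phi a) #<= below (h a).
Proof.
move=> [_ phih]; case E: (phi a) => [A|]; last exact: card_ge0.
by have /card_eqPle[] := phih _ _ E.
Qed.

Lemma in_star_normal (h : K -> K) phi (f : K -> K) :
  is_slalom h phi -> in_star f phi -> D [set a | odflt set0 (phi a) (f a)].
Proof.
have [_ _ Dgt _] := D_normal; move=> [[c domc] _] [b bf].
apply: filterS2 (Dgt b) (Dgt c) => a ba ca /=; case E: (phi a) => [A|] /=.
  apply: contrapT => nAf; have : a < b by apply: bf; exists A.
  by rewrite ltNge (ltW ba).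
have : a < c by apply: domc => /=; apply.
by rewrite ltNge (ltW ca).
Qed.

End Fodor.

(** Pad [B a] with the ordinal [h a] to give it the exact cardinality |h a|, and
    leave the slalom undefined on an initial segment that contains the finite
    [a], for which padding may fail. *)
Lemma slalom_containing (h : K -> K) (B : K -> set K) :
  (forall a, a <= h a) ->
  (forall a, infinite_set (below a) -> B a #<= below (h a)) ->
  exists2 phi, is_slalom h phi &
    forall f, is_bounded [set a | ~ B a (f a)] -> in_star f phi.
Proof.
move=> hge Bh; have [c cinf] := infinite_below.
exists (fun a => if c <= a then Some (B a `|` below (h a)) else None).
  split.
    exists c => a /=; rewrite /sdom /= => nn; rewrite ltNge; apply/negP => ca.
    by apply: nn; rewrite ca.
  move=> a A; case: ifP => // ca [<-]; apply/card_eqPle; split.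
    apply: card_le_setU => //; first exact/cinf/(le_trans ca).
    exact/Bh/cinf.
  by apply: subset_card_le => b; right.
move=> f [b fb]; exists b => a /= [A]; case: ifP => // ca [<-] nBf; apply: fb => /= Bf.
by apply: nBf; left.
Qed.

(** * The two invariants *)

Lemma le_ord_card_succ (a : K) : a <= ord_card_succ a.
Proof.
rewrite /ord_card_succ; case: xgetP => // x -> [/andP[_ /negP nxa] _].
rewrite leNgt; apply/negP => xa; apply: nxa; apply: subset_card_le => b bx.
exact: lt_trans xa.
Qed.

Lemma below_ord_card_succ (a b : K) :
  b < ord_card_succ a -> below b #<= below a.
Proof.
rewrite /ord_card_succ; case: xgetP => [x -> [_ xmin]|_] ba.
  apply: contrapT => /card_lt_not_le/xmin.
  by rewrite leNgt => /negP; apply.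
by apply: subset_card_le => c cb; exact: lt_trans ba.
Qed.

(** A function is determined by its graph, coded as a subset of [K]. *)
Lemma card_fun_le : [set: K -> K] #<= [set: set K].
Proof.
have [a0 _] := infinite_setN0 infinite_cardinal.
have := card_square_le infinite_cardinal.
rewrite setXTT => /(card_le_set_inj a0)[p _ pI].
apply: (@set_inj_card_le _ _ _ _ (fun f => [set p (a, f a) | a in [set: K]])) => //.
move=> f f' _ _ ff'; apply/funext => a.
have : [set p (a, f' a) | a in [set: K]] (p (a, f a)) by rewrite -ff'; exists a.
by move=> [b _ /pI]; rewrite !inE => /(_ I I) [-> ->].
Qed.

(** The functions [f x] for [x] in [X] form a witness, as a slalom captures at
    most |K| of them.  Conversely, if at most |K| functions are given, the
    slalom whose value at [a] consists of the values at [a] of the functions of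
    index below [a] captures all of them. *)
Lemma b_slalom_succ (D : set_system K) (f : set K -> K -> K) (X : set (set K)) :
  is_normal D ->
  (forall x y, x <> y -> exists c, forall a, c < a -> f x a <> f y a) ->
  is_card_succ [set: K] X -> b_slalom_is (fun a : K => a) X.
Proof.
move=> D_normal fsep [/card_lt_not_le nXK Xmin].
have [D_proper _ Dgt _] := D_normal.
have Dneq x y : x <> y -> D [set a | f x a <> f y a].
  by move=> /fsep[c cf]; apply: filterS (Dgt c).
split.
  exists (f @` X); last first.
    apply: inj_card_eq => x y _ _ fxy; apply: contrapT => /fsep[c cf].
    have [a /cf] := filter_ex (Dgt c); apply; by rewrite fxy.
  move=> phi slphi; apply: contrapT => ncap; apply: nXK.
  have fphi x : X x -> in_star (f x) phi.
    by move=> Xx; apply: contrapT => nf; apply: ncap; exists (f x) => //; exists x.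
  apply: (@fodor_card_le _ D_normal _ _ f (fun a => odflt set0 (phi a))).
  - by apply: filterE => a; exact: slalom_card_le slphi.
  - by move=> x /fphi; exact: (in_star_normal D_normal slphi).
  - by move=> x y _ _; exact: Dneq.
move=> F FP; apply: Xmin; apply/card_lt_not_le => FK.
have [a0 _] := infinite_setN0 infinite_cardinal.
have [i _ iI] := card_le_set_inj a0 FK.
have [//||phi slphi phiP] := @slalom_containing id
    (fun a => [set g a | g in F `&` [set g | i g < a]]).
  move=> a _; apply: card_le_trans (card_image_le _ _) _.
  apply: (@set_inj_card_le _ _ _ _ i); first by move=> g [].
  by move=> g g' /[!inE] -[Fg _] [Fg' _]; apply: iI; exact/mem_set.
have [g Fg] := FP phi slphi; apply; apply: phiP.
have [c ic] : exists c, i g < c by have [_ _ /(_ (i g))/filter_ex] := D_normal.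
exists c => a /= nBg; rewrite ltNge; apply/negP => ca; apply: nBg.
by exists g => //; split => //; exact: lt_le_trans ic ca.
Qed.

Section Dominating.
Variables (D : set_system K) (f : set K -> K -> K) (h : K -> K).
Hypotheses (D_normal : is_normal D)
  (fsep : forall x y, x <> y -> exists c, forall a, c < a -> f x a <> f y a)
  (hge : forall a, a <= h a)
  (hcard : forall a b, b < h a -> below b #<= below a).

Definition predicts (S : set (K -> option (set K))) :=
  S `<=` is_slalom h /\ forall g, exists2 phi, S phi & in_star g phi.

(** Index [S] injectively by elements of [K] and let [g a] avoid the values at
    [a] of the slaloms of index below [a]: fewer than |K| points are to be
    avoided, and no slalom of [S] captures [g]. *)
Lemma predicting_not_le S : predicts S -> ~ (S #<= [set: K]).
Proof.
have [D_proper _ Dgt _] := D_normal.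
move=> [Sh Scap] SK; have [a0 _] := infinite_setN0 infinite_cardinal.
have [i _ iI] := card_le_set_inj a0 SK; have [c cinf] := infinite_below.
pose B a := \bigcup_(phi in S `&` [set phi | i phi < a]) odflt set0 (phi a).
have /choice[g gP] a : exists z, c <= a -> ~ B a z.
  have [ca|] := boolP (c <= a); last by exists a0.
  have Ble : B a #<= below (h a).
    apply: card_le_bigcup.
    - by apply: cinf; exact: le_trans (hge a).
    - apply: (@card_le_trans _ _ _ (below a)).
        apply: (@set_inj_card_le _ _ _ _ i); first by move=> phi [].
        by move=> p q /[!inE] -[Sp _] [Sq _]; apply: iI; exact/mem_set.
      by apply: subset_card_le => b ba; exact: lt_le_trans (hge a).
    - by move=> phi [/Sh slphi _]; exact: slalom_card_le slphi.
  apply: contrapT => nz; apply: (@not_card_le_below (h a)).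
  apply: card_le_trans Ble; apply: subset_card_le => z _.
  by apply: contrapT => nBz; apply: nz; exists z.
have [phi Sphi gphi] := Scap g.
have [a [[ca ia] phig]] := filter_ex (filterI (filterI (Dgt c) (Dgt (i phi)))
  (in_star_normal D_normal (Sh _ Sphi) gphi)).
by apply: (gP a (ltW ca)); exists phi.
Qed.

(** Each slalom of [S] captures at most kappa^+ of the functions [f x], and
    kappa^+ is at most |S| since |S| is more than kappa. *)
Lemma card_powerset_le_predicting S : predicts S -> [set: set K] #<= S.
Proof.
have [D_proper _ Dgt _] := D_normal.
move=> SP; have nSK := predicting_not_le SP; move: SP => [Sh Scap].
apply: (@card_le_trans _ _ _
    (\bigcup_(phi in S) [set x | in_star (f x) phi])).
  by apply: subset_card_le => x _; have [phi Sphi xphi] := Scap (f x); exists phi.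
have KS : [set: K] #<= S by have [/nSK|] := card_le_total S [set: K].
apply: card_le_bigcup => //.
  by move=> /(card_le_finite KS)/infinite_cardinal.
move=> phi /Sh slphi.
apply: (@fodor_card_le_succ _ D_normal h _ _ f (fun a => odflt set0 (phi a))) => //.
- by apply: filterE => a; exact: slalom_card_le slphi.
- by move=> x; exact: (in_star_normal D_normal slphi).
- by move=> x y _ _ /fsep[e ef]; apply: filterS (Dgt e).
Qed.

Lemma d_slalom_powerset : d_slalom_is h [set: set K].
Proof.
split; last by move=> S SP; exact: card_powerset_le_predicting.
have [c cinf] := infinite_below.
have /choice[s sP] (g : K -> K) : exists phi, is_slalom h phi /\ in_star g phi.
  have [//||phi ? phiP] := @slalom_containing h (fun a => [set g a]).
    move=> a ainf; apply: (@card_le_trans _ _ _ (below a)).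
      apply: card_le_trans ((infiniteP _).1 ainf); exact: countable1.
    by apply: subset_card_le => b ba; exact: lt_le_trans (hge a).
  exists phi; split=> //; apply: phiP; exists c => a /=.
  by move=> /(_ erefl).
have sS : predicts (range s).
  split; first by move=> _ [g _ <-]; have [] := sP g.
  by move=> g; exists (s g); [exists g | have [] := sP g].
exists (range s) => //; apply/card_eqPle; split.
  exact: card_le_trans (card_image_le _ _) card_fun_le.
exact: card_powerset_le_predicting.
Qed.

End Dominating.
End UncountableCardinal.

Theorem mainTheorem1 (d : Order.disp_t) (K : orderType d)
  (hK : is_measurable_cardinal K) :
  [/\ exists (U : Type) (X : set U),
        is_card_succ [set: K] X /\ b_slalom_is (fun a : K => a) X,
      d_slalom_is (fun a : K => a) [set: set K] &
      d_slalom_is (fun a : K => ord_card_succ a) [set: set K]].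
Proof.
have [cardK uncK [U [U_ultra U_npr U_comp]]] := hK.
have [D D_normal] := exists_normal cardK uncK U_ultra U_npr U_comp.
have [f fsep] := exists_separated uncK (fun a =>
  measurable_powerset_le cardK a U_ultra U_npr U_comp).
split.
- have [X Xsucc] := exists_card_succ (infinite_cardinal uncK).
  by exists (set K), X; split=> //; exact: b_slalom_succ D_normal fsep Xsucc.
- apply: (d_slalom_powerset cardK uncK D_normal fsep) => // a b ba.
  by apply: subset_card_le => c cb; exact: lt_trans ba.
- apply: (d_slalom_powerset cardK uncK D_normal fsep).
    exact: le_ord_card_succ.
  exact: below_ord_card_succ.
Qed.
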